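(* Let $\kappa$ be a cardinal and let $U$ be the graph with vertex set $V(U)=\bigcup_{n<\omega}\kappa^n$ and $\mathbb{Z}$-labelled edge set $E(U)=\{u \xrightarrow{w} u' \mid |u|+w\ge |u'| \text{ and } [\,|u|+w=|u'| \implies u>_{\mathrm{lex}} u'\,]\}$. Then $U$ is $(\kappa,\mathsf{SumToInfinity})$-almost-universal, where $\mathsf{SumToInfinity}=\{w_0w_1\ldots\in\mathbb{Z}^\omega \mid \lim_{k\to\infty}\sum_{i=0}^{k-1}w_i=+\infty\}$.
   Context: For a tuple $u=(u_0,\dots,u_n)$ of ordinals, $|u|$ denotes its length and $u_{<i}=(u_0,\dots,u_{i-1})$; $u>_{\mathrm{lex}}u'$ iff $u'$ is a proper prefix of $u$ or there is $i$ with $u_{<i}=u'_{<i}$ and $u_i>u'_i$. Graphs are directed with edges labelled by integers. A graph satisfies an objective $W\subseteq\mathbb{Z}^\omega$ if the label sequence of every infinite path in it belongs to $W$. A tree is a graph with a root $t_0$ such that every vertex admits a unique path from $t_0$. A morphism from $G$ to $H$ is a map $f:V(G)\to V(H)$ such that for every edge $v\xrightarrow{c}v'$ of $G$, $f(v)\xrightarrow{c}f(v')$ is an edge of $H$; write $G\to H$ if one exists. For a vertex $v_0$ of $T$, $T[v_0]$ is the restriction of $T$ to vertices reachable from $v_0$. For a prefix-independent objective $W$ and cardinal $\kappa$, a graph $U$ is $(\kappa,W)$-almost-universal if $U$ satisfies $W$ and for every tree $T$ with fewer than $\kappa$ vertices satisfying $W$, there is a vertex $v_0$ of $T$ with $T[v_0]\to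 U$. *)

(* Defs.v *)
From mathcomp Require Import all_boot all_order all_algebra.
From mathcomp Require Import boolp classical_sets functions cardinality.

Set Implicit Arguments.
Unset Strict Implicit.
Unset Printing Implicit Defensive.

Import Order.TTheory GRing.Theory Num.Theory.

Local Open Scope classical_set_scope.
Local Open Scope card_scope.
Local Open Scope ring_scope.

Record graph : Type := Graph {
  vertex :> Type;
  edge : vertex -> int -> vertex -> Prop
}.

(* A finite path is given by its source and the list of its successive
   (label, target) pairs; in particular, edges with the same endpoints and
   different labels yield different paths. *)
Fixpoint is_path (G : graph) (v : G) (p : seq (int * G)) (v' : G) : Prop :=
  if p is (c, w) :: p' then edge v c w /\ is_path w p' v' else v = v'.

Definition reachable (G : graph) (v v' : G) : Prop :=
  exists p, is_path v p v'.

Definition is_tree (G : graph) : Prop :=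
  exists t0 : G, forall v : G, exists! p, is_path t0 p v.

Definition restrict_from (G : graph) (v0 : G) : graph :=
  @Graph {v : G | reachable v0 v} (fun x c y => edge (sval x) c (sval y)).

Definition is_morphism (G H : graph) (f : G -> H) : Prop :=
  forall (v : G) (c : int) (v' : G), edge v c v' -> edge (f v) c (f v').

Definition maps_to (G H : graph) : Prop :=
  exists f : G -> H, is_morphism f.

Definition objective : Type := set (nat -> int).

Definition prefix_independent (W : objective) : Prop :=
  forall (n : nat) (w : nat -> int), W w <-> W (fun i => w (n + i)%N).

Definition satisfies (G : graph) (W : objective) : Prop :=
  forall (v : nat -> G) (c : nat -> int),
    (forall i, edge (v i) (c i) (v i.+1)) -> W c.

(* The limit of the partial sums is +oo, spelled out for integer sequences. *)
Definition SumToInfinity : objective :=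
  [set w : nat -> int | forall M : int, exists N : nat, forall k : nat,
     (N <= k)%N -> M <= \sum_(i < k) w i].

(* A cardinal is represented as an initial ordinal: a well-ordered type that is
   not equipotent to any of its proper initial segments. Its elements are the
   ordinals below the cardinal. It may be finite, including empty. *)
Record is_cardinal (d : Order.disp_t) (K : orderType d) : Prop := IsCardinal {
  cardinal_wf : well_founded (fun x y : K => (x < y)%O);
  cardinal_initial : forall x : K, ~~ ([set y : K | (y < x)%O] #= [set: K])
}.

Definition fewer_than (V K : Type) : Prop :=
  ([set: V] #<= [set: K]) /\ ~~ ([set: K] #<= [set: V]).

(* Only meant for prefix-independent W; only the cardinality of K matters. *)
Definition almost_universal (K : Type) (W : objective) (U : graph) : Prop :=
  satisfies U W /\
  forall T : graph, is_tree T -> fewer_than T K -> satisfies T W ->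
    exists v0 : T, maps_to (restrict_from v0) U.

Definition gt_lex (d : Order.disp_t) (K : orderType d) (u u' : seq K) : Prop :=
  (prefix u' u /\ u' <> u) \/
  exists (i : nat) (a a' : K),
    [/\ onth u i = Some a, onth u' i = Some a',
        take i u = take i u' & (a' < a)%O].

(* [seq K] is the union over n of the sets of n-tuples of elements of K. *)
Definition sum_graph (d : Order.disp_t) (K : orderType d) : graph :=
  @Graph (seq K) (fun u w u' =>
    (size u')%:Z <= (size u)%:Z + w /\
    ((size u)%:Z + w = (size u')%:Z -> gt_lex u u')).

Lemma SumToInfinity_prefix_independent : prefix_independent SumToInfinity.
Proof.
move=> n w.
have E k : \sum_(i < n + k) w i = \sum_(i < n) w i + \sum_(i < k) w (n + i)%N.
  by rewrite big_split_ord.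
split=> H M.
  have [N HN] := H (M + \sum_(i < n) w i).
  exists N => k le_Nk.
  rewrite -(lerD2r (\sum_(i < n) w i)) [leRHS]addrC -E.
  by apply: HN; apply: leq_trans le_Nk _; apply: leq_addl.
have [N HN] := H (M - \sum_(i < n) w i).
exists (n + N)%N => k le_k.
have le_nk : (n <= k)%N by apply: leq_trans le_k; apply: leq_addr.
rewrite -(subnKC le_nk) E -lerBlDl.
by apply: HN; rewrite leq_subRL.
Qed.

(* Main.v *)
(** Along an infinite path of [sum_graph], the partial sums equal the variation
    of the length plus a nonnegative accumulated slack. If they do not tend to
    infinity, the slack is eventually constant, so the words eventually decrease
    lexicographically while having bounded length infinitely often; this is
    impossible since the lexicographic order is well founded on words of bounded
    length.

    Conversely, let [T] satisfy the objective. Some [v0] has no outgoing path of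
    negative weight, since otherwise one could concatenate such paths forever.
    For [v] reachable from [v0], let [phi v] be the opposite of the least weight
    of a path from [v]; then [phi v' <= phi v + c] on every edge, and sums along
    paths of tight edges (those with equality) are variations of [phi]. Hence
    [phi] tends to infinity along infinite tight paths, so for each [n] the
    relation "there is a nonempty tight path from [y] to [x] leaving a vertex of
    potential at most [n]" is well founded. With [r n] its rank function, the
    morphism sends [v] to the word [r 0 v, ..., r (phi v) v]. *)
Require Import Defs.
From mathcomp Require Import all_boot all_order all_algebra.
From mathcomp Require Import boolp classical_sets functions cardinality.
From mathcomp Require Import zify.

Set Implicit Arguments.
Unset Strict Implicit.
Unset Printing Implicit Defensive.

Import Order.TTheory GRing.Theory Num.Theory.

Local Open Scope classical_set_scope.
Local Open Scope card_scope.
Local Open Scope ring_scope.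

(** * Well-founded relations and the lexicographic order *)

Lemma no_chain_wf (T : Type) (R : T -> T -> Prop) :
  (forall x : nat -> T, ~ forall k, R (x k.+1) (x k)) -> well_founded R.
Proof.
move=> noR x0; apply: contrapT => nAx0.
have step (x : {x | ~ Acc R x}) : exists y : {x | ~ Acc R x}, R (sval y) (sval x).
  case: x => x nAx /=; apply: contrapT => noy; apply: nAx; constructor=> y Ryx.
  by apply: contrapT => nAy; apply: noy; exists (exist _ y nAy).
have [f fR] := choice step.
apply: (noR (fun k => sval (iter k f (exist _ x0 nAx0)))) => k.
exact: fR.
Qed.

Lemma wf_least (d : Order.disp_t) (K : orderType d) (A : set K) :
  well_founded (fun x y : K => (x < y)%O) ->
  A !=set0 -> exists2 m, A m & forall k, A k -> (m <= k)%O.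
Proof.
move=> wfK [k]; elim/(well_founded_ind wfK): k => k IH Ak.
have [[k' [Ak' ltk]]|nok] := pselect (exists k', A k' /\ (k' < k)%O).
  exact: IH Ak'.
exists k => // k' Ak'; rewrite leNgt; apply/negP => ltk.
by apply: nok; exists k'.
Qed.

Lemma gt_lex_ltxi (d : Order.disp_t) (K : orderType d) (u u' : seq K) :
  gt_lex u u' -> (u' < u :> seqlexi K)%O.
Proof.
elim: u' u => [|a' u' IH] [|a u].
- by case=> [[_ /(_ erefl)//]|[i [? [? []]]]]; rewrite onth0n.
- by [].
- by case=> [[]//|[i [? [? []]]]]; rewrite onth0n.
move=> gt_u; rewrite ltxi_cons.
have [[-> /IH ltu]|lta] : a' = a /\ gt_lex u u' \/ (a' < a)%O.
  case: gt_u => [[/= /andP[/eqP<- pre] neq]|[[|i] [b [b' [/= + + + lt_b]]]]].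
  - by left; split=> //; left; split=> // eqs; apply: neq; rewrite eqs.
  - by move=> [->] [->]; right.
  - by move=> ui ui' [-> tk]; left; split=> //; right; exists i, b, b'.
  by rewrite lexx.
by rewrite ltW //= leNgt lta.
Qed.

(** Nested induction on the bound, the first letter and the tail. Only the smaller word is bounded,
    so a descent may start from a word of any length. *)
Lemma ltxi_bounded_wf (d : Order.disp_t) (K : orderType d) (n : nat) :
  well_founded (fun x y : K => (x < y)%O) ->
  well_founded (fun u' u : seqlexi K => (size u' <= n)%N /\ (u' < u)%O).
Proof.
move=> wfK; elim: n => [|n IHn].
  have nil_acc : Acc (fun u' u : seqlexi K => (size u' <= 0)%N /\ (u' < u)%O) [::].
    by constructor=> u []; rewrite ltxis0.
  by move=> u; constructor=> -[|a u'] [].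
set R := fun u' u => _.
have nil_acc : Acc R [::] by constructor=> u []; rewrite ltxis0.
move=> [|a s]; first exact: nil_acc.
elim/(well_founded_ind wfK): a s => a IHa s.
elim/(well_founded_ind IHn): s => s IHs.
constructor=> -[|a' s'] [les]; first by move=> _; exact: nil_acc.
rewrite ltxi_cons le_eqVlt => /andP[/orP[/eqP->|lta _]]; last exact: IHa.
by rewrite lexx => lts; apply: IHs.
Qed.

(** * The graph satisfies the objective *)

Lemma sum_graph_satisfies (d : Order.disp_t) (K : orderType d) :
  well_founded (fun x y : K => (x < y)%O) ->
  satisfies (sum_graph K) SumToInfinity.
Proof.
move=> wfK v c vE M; apply: contrapT => noN.
have [S [S0 SS freq]] : exists S : nat -> int,
    [/\ S 0%N = 0, forall k, S k.+1 = S k + c k &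
      forall N, exists k, (N <= k)%N /\ S k < M].
  exists (fun k => \sum_(i < k) c i); split=> [|k|N]; first exact: big_ord0.
    by rewrite big_ord_recr.
  apply: contrapT => nok; apply: noN; exists N => k leNk.
  by rewrite leNgt; apply/negP => ltM; apply: nok; exists k.
pose D k : int := S k + (size (v 0%N))%:Z - (size (v k))%:Z.
have DS k : D k.+1 = D k + ((size (v k))%:Z + c k - (size (v k.+1))%:Z).
  by rewrite /D SS; lia.
have D_mono : {homo D : i j / (i <= j)%N >-> i <= j}.
  apply: homo_leq => [//|y x z|k]; first exact: le_trans.
  by rewrite DS lerDl; have [+ _] := vE k; lia.
have D_ge0 k : 0 <= D k.
  by apply: le_trans (D_mono 0%N k _) => //; rewrite /D S0; lia.
(* Infinitely many partial sums lie below [M], which bounds the nondecreasing slack [D]. *)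
pose B := `|(M + (size (v 0%N))%:Z)%R|%N.
have D_ub k : D k <= B%:Z.
  have [k' [/D_mono + ltM]] := freq k; move: (ltM); rewrite {2}/D /B; lia.
pose P m := `[< exists k, D k = m%:Z >].
have exP : exists m, P m.
  by exists `|D 0%N|%N; apply/asboolP; exists 0%N; have := D_ge0 0%N; lia.
have ubP m : P m -> (m <= B)%N by move=> /asboolP[k Dk]; have := D_ub k; lia.
(* The maximum of [D] is reached at [n0] and kept from then on. *)
case: (ex_maxnP exP ubP) => m /asboolP[n0 Dn0] maxm.
have D_const k : D (n0 + k)%N = m%:Z.
  have := D_mono _ _ (leq_addr k n0).
  have /maxm : P `|D (n0 + k)%N|%N.
    by apply/asboolP; exists (n0 + k)%N; have := D_ge0 (n0 + k)%N; lia.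
  have := D_ge0 (n0 + k)%N; rewrite Dn0; lia.
have v_dec k : (v (n0 + k.+1)%N < v (n0 + k)%N :> seqlexi K)%O.
  apply: gt_lex_ltxi; rewrite addnS; have [_] := vE (n0 + k)%N; apply.
  have := DS (n0 + k)%N; rewrite -addnS !D_const; lia.
have v_anti i j : (i < j)%N -> (v (n0 + j)%N < v (n0 + i)%N :> seqlexi K)%O.
  by apply: (@homo_ltn _ (fun k => v (n0 + k)%N : seqlexi K) (fun x y => (y < x)%O))
    => [y x z xy yz|]; [exact: lt_trans yz xy | exact: v_dec].
(* Where [S] is below [M], [0 <= D] bounds the length by [B]. *)
have small k : exists2 k', (k < k')%N & (size (v (n0 + k')%N) <= B)%N.
  have [j [lej ltM]] := freq (n0 + k.+1)%N; exists (j - n0)%N; first by lia.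
  rewrite subnKC; last by lia.
  by have := D_ge0 j; rewrite /D /B; lia.
have none (u : seqlexi K) : ~ exists k, v (n0 + k)%N = u.
  elim/(well_founded_ind (ltxi_bounded_wf B wfK)): u => u IH [k vk].
  have [k' ltk sz] := small k; apply: (IH (v (n0 + k')%N)); last by exists k'.
  by rewrite -vk; split=> //; apply: v_anti.
by apply: (none (v n0)); exists 0%N; rewrite addn0.
Qed.

(** * Ranks with values in the cardinal *)

Lemma ex_not_surj (V K : Type) (f : V -> K) :
  ~~ ([set: K] #<= [set: V]) -> exists k, forall x, f x <> k.
Proof.
move/negP=> nle; apply: contrapT => nok; apply: nle.
have /Psurj[g _] : set_surj [set: V] [set: K] f.
  move=> k _; apply: contrapT => nk; apply: nok; exists k => x fx.
  by apply: nk; exists x.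
exact: surj_card_ge g.
Qed.

(* [r x] is the least element of [K] not attained by [r] below [x]. By
   transitivity the values attained below [x] form an initial segment, so no
   regularity assumption on the cardinal [K] is needed. *)
Lemma mex_rank (V : Type) (d : Order.disp_t) (K : orderType d)
    (lt : V -> V -> Prop) :
    well_founded (fun x y : K => (x < y)%O) -> ~~ ([set: K] #<= [set: V]) ->
    well_founded lt -> (forall x y z, lt x y -> lt y z -> lt x z) ->
  exists r : V -> K,
    (forall x y, (forall z, lt z x -> lt z y) -> (r x <= r y)%O) /\
    (forall x y, lt x y -> (r x < r y)%O).
Proof.
move=> wfK nle wflt lt_trans.
(* [k0] serves as the default value of [mex] on the full set. *)
have [k0 _] : exists k0 : K, True.
  apply: contrapT => noK; move: nle => /negP; apply.
  suff -> : [set: K] = set0 by exact: card_ge0.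
  by rewrite -subset0 => k _; apply: noK; exists k.
have /choice[mex mexP] : forall A : set K, exists m, ~` A !=set0 ->
    ~ A m /\ forall k, ~ A k -> (m <= k)%O.
  move=> A.
  have [A0|] := pselect (~` A !=set0); last by exists k0.
  by have [m Am mmin] := wf_least wfK A0; exists m.
pose r := Fix wflt (fun=> K) (fun x rec =>
  mex [set k | exists y (h : lt y x), rec y h = k]).
pose A x := [set k | exists2 y, lt y x & r y = k].
have rE x : r x = mex (A x).
  rewrite /r Fix_eq => [|{}x f g fg].
    congr mex; apply/seteqP; split=> k /=.
      by move=> [y [h <-]]; exists y.
    by move=> [y h <-]; exists y, h.
  congr mex; apply/seteqP.
  by split=> k [y [h <-]]; exists y, h; rewrite fg.
(* [r] is not surjective, as [K] does not inject into [V], so some value is left. *)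
have rP x : ~ A x (r x) /\ forall k, ~ A x k -> (r x <= k)%O.
  rewrite rE; apply: mexP; have [k rk] := ex_not_surj r nle.
  by exists k => -[y _]; apply: rk.
have rle x y : (forall z, lt z x -> lt z y) -> (r x <= r y)%O.
  move=> sub; apply: (rP x).2 => -[z ltzx rz]; apply: (rP y).1.
  by exists z => //; apply: sub.
exists r; split=> // x y ltxy; rewrite lt_neqAle rle ?andbT; last first.
  by move=> z ltzx; apply: lt_trans ltxy.
by apply/eqP => rxy; apply: (rP y).1; exists x.
Qed.

(** * Weighted paths and their concatenation *)

Definition weight (G : graph) (p : seq (int * G)) : int := \sum_(e <- p) e.1.

Lemma weight_cat (G : graph) (p q : seq (int * G)) :
  weight (p ++ q) = weight p + weight q.
Proof. exact: big_cat. Qed.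

Lemma weight_cons (G : graph) (c : int) (v : G) (p : seq (int * G)) :
  weight ((c, v) :: p) = c + weight p.
Proof. exact: big_cons. Qed.

Lemma is_path_cat (G : graph) (v v' v'' : G) (p q : seq (int * G)) :
  is_path v p v' -> is_path v' q v'' -> is_path v (p ++ q) v''.
Proof.
elim: p v => [|[c w] p IH] v /=; first by move=> ->.
by move=> [vw /IH{}IH] /IH.
Qed.

Lemma reachable_trans (G : graph) (v v' v'' : G) :
  reachable v v' -> reachable v' v'' -> reachable v v''.
Proof. by move=> [p vp] [q vq]; exists (p ++ q); apply: is_path_cat vq. Qed.

Lemma reachable_edge (G : graph) (v v' : G) (c : int) :
  edge v c v' -> reachable v v'.
Proof. by move=> vv'; exists [:: (c, v')]. Qed.

Lemma concat_paths (G : graph) (x : nat -> G) (p : nat -> seq (int * G)) :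
    (forall k, is_path (x k) (p k) (x k.+1)) -> (forall k, p k <> [::]) ->
  exists (v : nat -> G) (c : nat -> int),
    (forall i, edge (v i) (c i) (v i.+1)) /\
    forall k, exists n, [/\ (k <= n)%N, v n = x k &
      \sum_(i < n) c i = \sum_(j < k) weight (p j)].
Proof.
move=> xp pn0.
(* A state [(w, q, k)] has current vertex [w] and remaining part [q] of [p k]. *)
pose next (s : G * seq (int * G) * nat) := match s with
  | (_, (_, w) :: [::], k) => (w, p k.+1, k.+1)
  | (_, (_, w) :: q, k) => (w, q, k)
  | _ => s end.
pose st n := iter n next (x 0%N, p 0%N, 0%N).
pose v n := (st n).1.1.
pose c n := if (st n).1.2 is (b, _) :: _ then b else 0.
have stS n : st n.+1 = next (st n) by [].
(* The remaining part is never empty, so the default branches of [next] and [c] are not reached. *)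
have inv n : (st n).1.2 <> [::] /\ is_path (v n) (st n).1.2 (x (st n).2.+1).
  elim: n => [|n]; first by split; [exact: pn0 | exact: xp].
  rewrite /v stS; case: (st n) => [[w q] k] /= [].
  case: q => [|[b w'] [|[b' w''] q]] //= _.
  - by move=> [_ ->]; split; [exact: pn0 | exact: xp].
  - by move=> [_ ?].
exists v, c; split=> [n|].
  have [] := inv n; rewrite /v /c stS; case: (st n) => [[w q] k] /=.
  by case: q => [|[b w'] [|[b' w''] q]] //= _ [].
have run q : forall n w k, q <> [::] -> is_path w q (x k.+1) -> st n = (w, q, k) ->
    st (n + size q)%N = (x k.+1, p k.+1, k.+1) /\
    \sum_(i < n + size q) c i = \sum_(i < n) c i + weight q.
  elim: q => [//|[b w'] q IH] n w k _ /= [_ pq] stn; rewrite -[in st _]addSnnS -addSnnS.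
  have cn : c n = b by rewrite /c stn.
  rewrite weight_cons.
  case: q => [|e q] in IH pq stn *.
    rewrite /= in pq.
    by rewrite !addn0 stS stn /= pq big_ord_recr /= cn /weight big_nil addr0.
  have /IH : st n.+1 = (w', e :: q, k) by rewrite stS stn.
  case=> // -> ->; split=> //.
  by rewrite big_ord_recr /= cn addrA.
suff hit k : exists n, [/\ (k <= n)%N, st n = (x k, p k, k) &
    \sum_(i < n) c i = \sum_(j < k) weight (p j)].
  by move=> k; have [n [? sn ?]] := hit k; exists n; split; rewrite // /v sn.
elim: k => [|k [n [le_kn stn sumn]]]; first by exists 0%N; rewrite !big_ord0.
have [st' sum'] := run _ _ _ _ (@pn0 k) (xp k) stn.
exists (n + size (p k))%N; split=> //.
  have : (0 < size (p k))%N by case: (p k) (@pn0 k).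
  lia.
by rewrite sum' big_ord_recr sumn.
Qed.

(** * The potential *)

Lemma ex_nonneg_source (T : graph) (t0 : T) : satisfies T SumToInfinity ->
  exists v0 : T, forall p v', is_path v0 p v' -> 0 <= weight p.
Proof.
move=> satT; apply: contrapT => nov0.
have step (v : T) : exists e : seq (int * T) * T,
    is_path v e.1 e.2 /\ weight e.1 < 0.
  apply: contrapT => noe; apply: nov0; exists v => p v' vp.
  by rewrite leNgt; apply/negP => p_lt0; apply: noe; exists (p, v').
have [f fP] := choice step.
pose x k := iter k (fun v => (f v).2) t0.
have [||v [c [vc hit]]] := @concat_paths T x (fun k => (f (x k)).1).
- by move=> k; exact: (fP _).1.
- by move=> k p0; have := (fP (x k)).2; rewrite p0 /weight big_nil ltxx.
(* The concatenated path has partial sum at most 0 at every [x k], so the bound 1 already fails. *)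
have [N /= HN] := satT v c vc 1.
have [n [/HN + _ sumn]] := hit N.
suff: \sum_(j < N) weight (f (x j)).1 <= 0 by rewrite sumn; lia.
by apply: sumr_le0 => j _; apply: ltW; exact: (fP _).2.
Qed.

Lemma ex_potential (T : graph) (t0 : T) : satisfies T SumToInfinity ->
  exists (v0 : T) (phi : T -> nat), forall v c v', reachable v0 v ->
    edge v c v' -> (phi v')%:Z <= (phi v)%:Z + c.
Proof.
move=> /(ex_nonneg_source t0)[v0 v0P]; exists v0.
have /choice[phi phiP] : forall v, exists n : nat, reachable v0 v ->
    (exists p v', is_path v p v' /\ weight p = - n%:Z) /\
    forall p v', is_path v p v' -> - n%:Z <= weight p.
  move=> v.
  have [[q vq]|] := pselect (reachable v0 v); last by exists 0%N.
  (* Prefixing a path [q] from [v0] bounds all weights from [v] below, so a least one exists. *)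
  have lb p v' : is_path v p v' -> - weight q <= weight p.
    by move=> /(is_path_cat vq)/v0P; rewrite weight_cat; lia.
  pose P n := `[< exists p v', is_path v p v' /\ weight p = - n%:Z >].
  have exP : exists n, P n.
    by exists 0%N; apply/asboolP; exists [::], v; rewrite /weight big_nil.
  have ubP n : P n -> (n <= `|weight q|)%N.
    by move=> /asboolP[p [v' [/lb]]]; lia.
  case: (ex_maxnP exP ubP) => n /asboolP nP maxn; exists n => _; split=> // p v' vp.
  rewrite leNgt; apply/negP => ltp.
  have /maxn : P `|weight p|%N by apply/asboolP; exists p, v'; split=> //; lia.
  by lia.
exists phi => v c v' v0v vv'.
have [[p [w [v'p wp]]] _] := phiP _ (reachable_trans v0v (reachable_edge vv')).
have /= := (phiP _ v0v).2 ((c, v') :: p) w (conj vv' v'p).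
by rewrite weight_cons wp; lia.
Qed.

(** * Tight paths and comparison of words of ranks *)

Definition tight_graph (T : graph) (phi : T -> nat) : graph :=
  @Graph T (fun v c v' => edge v c v' /\ (phi v')%:Z = (phi v)%:Z + c).

(* The potential is bounded at a source [z] rather than at a target: a tight edge
   out of [v] then strictly decreases the rank of every index [n >= phi v]. *)
Definition visits (T : graph) (phi : T -> nat) (n : nat) (x y : T) : Prop :=
  exists (z : tight_graph phi) (c : int), reachable (y : tight_graph phi) z /\
    (phi z <= n)%N /\ edge z c (x : tight_graph phi).

Lemma visits_reachable (T : graph) (phi : T -> nat) (n : nat) (x y z : T) :
  reachable (z : tight_graph phi) y -> visits phi n x y -> visits phi n x z.
Proof.
by move=> zy [w [c [yw wx]]]; exists w, c; split=> //; apply: reachable_trans yw.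
Qed.

Lemma visits_trans (T : graph) (phi : T -> nat) (n : nat) (x y z : T) :
  visits phi n x y -> visits phi n y z -> visits phi n x z.
Proof.
move=> xy [w [c [zw [_ wy]]]]; apply: visits_reachable xy.
exact: reachable_trans zw (reachable_edge wy).
Qed.

Lemma visits_wf (T : graph) (phi : T -> nat) (n : nat) :
  satisfies T SumToInfinity -> well_founded (visits phi n).
Proof.
move=> satT; apply: no_chain_wf => x xP.
(* The sources [z k] lie on one infinite tight path and all have potential at most [n]. *)
have [z zP] := choice xP.
have zpath k : exists p, is_path (z k) p (z k.+1) /\ p <> [::].
  have [c [_ [_ zx]]] := zP k; have [_ [[q xq] _]] := zP k.+1.
  by exists ((c, x k.+1) :: q).
have [p pP] := choice zpath.
have [k|k|v [c [vc hit]]] := @concat_paths _ z p; try by case: (pP k).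
have sumE k : \sum_(i < k) c i = (phi (v k))%:Z - (phi (v 0%N))%:Z.
  elim: k => [|k IH]; first by rewrite big_ord0 subrr.
  have [_ ->] := vc k; rewrite big_ord_recr /= IH addrAC; lia.
(* A partial sum of at least [n + 1] forces a potential above [n]. *)
have [N /= HN] := satT v c (fun i => (vc i).1) n.+1%:Z.
have [m [/HN + vm _]] := hit N.
have [_ [_ [+ _]]] := zP N; rewrite sumE vm; lia.
Qed.

(** The first index at most [minn m m'] where [r] and [r'] differ decides. If there is none,
    strictness at [m] gives [m' < m], hence a proper prefix. *)
Lemma gt_lex_mkseq (d : Order.disp_t) (K : orderType d) (r r' : nat -> K)
    (m m' : nat) :
    (forall i, (r' i <= r i)%O) -> (forall i, (m <= i)%N -> (r' i < r i)%O) ->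
  gt_lex (mkseq r m.+1) (mkseq r' m'.+1).
Proof.
move=> le_r lt_r.
have take_mk (f : nat -> K) i n : (i <= n)%N -> take i (mkseq f n) = mkseq f i.
  by move=> le_in; rewrite /mkseq -map_take take_iota (minn_idPl le_in).
have onth_mk (f : nat -> K) i n : (i < n)%N -> onth (mkseq f n) i = Some (f i).
  by move=> lt_in; rewrite onthE -map_comp (nth_map 0%N) ?size_iota // nth_iota.
have [exi|noi] := pselect (exists i, (i <= minn m m')%N && (r' i != r i)).
  case: (ex_minnP exi) => i /andP[]; rewrite leq_min => /andP[im im'] neq min_i.
  right; exists i, (r i), (r' i); split.
  - by rewrite onth_mk.
  - by rewrite onth_mk.
  - rewrite !take_mk ?(leqW im) ?(leqW im') //.
    apply/eq_in_map => j; rewrite mem_iota add0n /= => ltji.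
    apply/eqP; rewrite eq_sym; apply/negPn/negP => neqj.
    suff : (i <= j)%N by rewrite leqNgt ltji.
    by apply: min_i; rewrite neqj leq_min !(leq_trans (ltnW ltji)).
  - by rewrite lt_neqAle neq le_r.
have eq_r i : (i <= minn m m')%N -> r' i = r i.
  by move=> lei; apply: contrapT => /eqP neq; apply: noi; exists i; rewrite lei.
have lt_m : (m' < m)%N.
  rewrite ltnNge; apply/negP => le_m; have := lt_r m (leqnn m).
  by rewrite eq_r ?ltxx // (minn_idPl le_m).
left; split; last by move=> /(congr1 size); rewrite !size_mkseq; lia.
apply/prefixP; exists (drop m'.+1 (mkseq r m.+1)).
rewrite -[LHS](cat_take_drop m'.+1) take_mk; last by lia.
congr (_ ++ _); apply/eq_in_map => i; rewrite mem_iota => lei.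
by rewrite eq_r // leq_min; lia.
Qed.

(** * The morphism into the sum graph *)

Theorem theorem5 (d : Order.disp_t) (kappa : orderType d)
    (kappa_cardinal : is_cardinal kappa) :
  almost_universal kappa SumToInfinity (sum_graph kappa).
Proof.
have [wfK _] := kappa_cardinal; split; first exact: sum_graph_satisfies.
move=> T [t0 _] [_ nle] satT.
have [v0 [phi phiP]] := ex_potential t0 satT; exists v0.
have /choice[r rP] : forall n, exists r : T -> kappa,
    (forall x y, (forall z, visits phi n z x -> visits phi n z y) ->
      (r x <= r y)%O) /\
    (forall x y, visits phi n x y -> (r x < r y)%O).
  move=> n.
  exact: (mex_rank wfK nle (@visits_wf T phi n satT) (@visits_trans T phi n)).
exists (fun x => mkseq (r^~ (sval x)) (phi (sval x)).+1).
move=> [v v0v] c [v' v0v'] vv'; split; rewrite !size_mkseq /=.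
  by have := phiP v c v' v0v vv'; lia.
move=> tight.
have {}vv' : @edge (tight_graph phi) v c v' by split=> //; lia.
(* What is visited from [v'] is visited from [v], so no rank increases. *)
apply: gt_lex_mkseq => i => [|le_i].
  by apply: (rP i).1 => z; apply: visits_reachable (reachable_edge vv').
by apply: (rP i).2; exists v, c; split=> //; exists [::].
Qed.
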